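(* Let $V$ be one of the three GAN objectives $V_c$ (classic GAN), $V_w$ (Wasserstein GAN with transport cost $c$) or $V_f$ ($f$-GAN). If $(\theta_d^*,\theta_g^* )\in\Theta_D\times\Theta_G$ is a configuration at which the generator learns the real data distribution, i.e. $P_{\theta_g^*}=P_r$, then the proximal duality gap with $\lambda=0$ vanishes at this configuration: $$P_{\theta_g^*}=P_r\ \Longrightarrow\ DG^{\lambda=0}(\theta_d^*,\theta_g^* )=0 .$$
   Context: A GAN game is $\min_{\theta_g\in\Theta_G}\max_{\theta_d\in\Theta_D}V(D_{\theta_d},G_{\theta_g})$, where $\theta_d$ parametrizes a discriminator $D_{\theta_d}$ (a function on the data space) and $\theta_g$ parametrizes a generator $G_{\theta_g}$ inducing a distribution $P_{\theta_g}$ on the data space. $P_r$ is the real data distribution. $P_r$ and all $P_{\theta_g}$ have densities with respect to a common measure $dx$, denoted by the same symbols. We write $V(\theta_d,\theta_g)$ for $V(D_{\theta_d},G_{\theta_g})$. Objectives, for a discriminator $D$: - Classic GAN: $V_c=\frac12\mathbb{E}_{x\sim P_r}[\log D(x)]+\frac12\mathbb{E}_{x\sim P_{\theta_g}}[\log(1-D(x))]$; admissible discriminators are measurable functions with values in $[0,1]$. - Wasserstein GAN: $V_w=\mathbb{E}_{x\sim P_r}[D(x)]-\mathbb{E}_{x\sim P_{\theta_g}}[D^c(x)]$, where $c(x,y)\ge 0$ is a transport cost with $c(x,x)=0$ and $D^c(x)=\sup_y\{D(y)-c(x,y)\}$ is the $c$-transform; admissible discriminators are the $c$-concave functions, i.e.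 $D(y)=\inf_x\{\varphi(x)+c(x,y)\}$ for some function $\varphi$. - $f$-GAN: $V_f=\mathbb{E}_{x\sim P_r}[D(x)]-\mathbb{E}_{x\sim P_{\theta_g}}[f^*(D(x))]$, where $f:\mathbb{R}_+\to\mathbb{R}$ is convex and lower semi-continuous with $f(1)=0$, and $f^*(x)=\sup_{t\in\mathrm{Dom}(f)}\{xt-f(t)\}$ is its Fenchel conjugate; admissible discriminators are measurable functions with values in the domain of $f^*$. Let $\|\cdot\|$ be a fixed norm (or seminorm) on discriminators. The proximal objective is $V^{\lambda}(\theta_d,\theta_g)=\max_{\tilde\theta_d\in\Theta_D}\{V(D_{\tilde\theta_d},G_{\theta_g})-\lambda\|D_{\tilde\theta_d}-D_{\theta_d}\|^2\}$ for $\lambda\ge0$. The proximal duality gap is $DG^{\lambda}(\theta_d,\theta_g)=V_{D_w}(\theta_g)-V^{\lambda}_{G_w}(\theta_d)$ with $V_{D_w}(\theta_g)=\max_{\theta_d'\in\Theta_D}V(D_{\theta_d'},G_{\theta_g})$ and $V^{\lambda}_{G_w}(\theta_d)=\min_{\theta_g'\in\Theta_G}V^{\lambda}(\theta_d,\theta_g')$. Standing assumptions: for each fixed generator an optimal discriminator $D_w$ exists, i.e. $V_{D_w}(\theta_g)$ is attained in $\Theta_D$, is a real number, and equals the supremum of $V$ over all admissible discriminators. All other displayed maxima and minima are assumed to exist. *)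

(* Defs.v *)
(* MathComp-Analysis, over an arbitrary R : realType. *)
From HB Require Import structures.
From mathcomp Require Export all_boot all_order all_algebra.
From mathcomp Require Export all_classical all_reals all_analysis.
(* for the Borel sigma-algebra of \bar R *)
From mathcomp Require Export measurable_realfun.

Set Implicit Arguments.
Unset Strict Implicit.
Unset Printing Implicit Defensive.

Import Order.TTheory GRing.Theory Num.Theory.
Import numFieldNormedType.Exports.

Local Open Scope classical_set_scope.
Local Open Scope ring_scope.

(* Maxima and minima are written as ereal_sup / ereal_inf; that they exist
   (are attained) is the separate property below. *)
Definition has_emax (R : realType) (S : set (\bar R)) : Prop := S (ereal_sup S).
Definition has_emin (R : realType) (S : set (\bar R)) : Prop := S (ereal_inf S).

Section Distributions.
Context (d : measure_display) (T : measurableType d) (R : realType).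
Local Open Scope ereal_scope.

Definition has_density (mu : {measure set T -> \bar R}) (P : probability T R) :=
  exists p : T -> R, [/\ measurable_fun [set: T] p,
    (forall x, 0 <= p x)%R &
    forall A, measurable A -> P A = \int[mu]_(x in A) (p x)%:E].

(* Equality as distributions; equality of the probability records would also
   compare the values on nonmeasurable sets. *)
Definition same_distribution (P Q : probability T R) : Prop :=
  forall A, measurable A -> P A = Q A.

(* The expectation of g under P makes sense in [-oo, +oo]. *)
Definition expectation_exists (P : probability T R) (g : T -> \bar R) : Prop :=
  measurable_fun [set: T] g /\
  (\int[P]_x g^\+ x < +oo \/ \int[P]_x g^\- x < +oo).

End Distributions.

Section Objectives.
Context (d : measure_display) (T : measurableType d) (R : realType).
Local Open Scope ereal_scope.

Definition ctransform (c : T -> T -> R) (D : T -> R) (x : T) : \bar R :=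
  ereal_sup [set (D y - c x y)%:E | y in [set: T]].

(* The function phi generating a c-concave function may take infinite values,
   as is usual in optimal transport; D itself is real-valued. *)
Definition cconcave (c : T -> T -> R) (D : T -> R) : Prop :=
  exists phi : T -> \bar R, forall y,
    (D y)%:E = ereal_inf [set phi x + (c x y)%:E | x in [set: T]].

(* Fenchel conjugate of f : [0, +oo[ -> R, represented by a function on R whose
   values at negative arguments are irrelevant; Dom(f) is thus [0, +oo[. *)
Definition fenchel (f : R -> R) (y : R) : \bar R :=
  ereal_sup [set (y * t - f t)%:E | t in `[0%R, +oo[].

Variant objective : Type :=
  | ClassicGAN
  | WassersteinGAN of T -> T -> R
  | FGAN of R -> R.

(* Lower semicontinuity of f is relative to the subspace [0, +oo[. *)
Definition valid_objective (o : objective) : Prop :=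
  match o with
  | ClassicGAN => True
  | WassersteinGAN c =>
      (forall x y, (0 <= c x y)%R) /\ (forall x, c x x = 0%R)
  | FGAN f =>
      [/\ convex_function (`[0%R, +oo[ : set R) f,
          lower_semicontinuous
            ((fun t => (f t)%:E) : subspace (`[0%R, +oo[ : set R) -> \bar R) &
          f 1%R = 0%R]
  end.

(* The value V for real distribution P, generated distribution Q and
   discriminator D; lne is the logarithm on [0, +oo] with lne 0 = -oo. *)
Definition gan_value (o : objective) (P Q : probability T R) (D : T -> R) :
    \bar R :=
  match o with
  | ClassicGAN =>
      (2^-1)%:E * (\int[P]_x lne (D x)%:E) +
      (2^-1)%:E * (\int[Q]_x lne (1 - D x)%:E)
  | WassersteinGAN c => \int[P]_x (D x)%:E - \int[Q]_x ctransform c D x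
  | FGAN f => \int[P]_x (D x)%:E - \int[Q]_x fenchel f (D x)
  end.

Definition admissible (o : objective) (D : T -> R) : Prop :=
  match o with
  | ClassicGAN => measurable_fun [set: T] D /\ (forall x, 0 <= D x <= 1)%R
  | WassersteinGAN c => cconcave c D
  | FGAN f => measurable_fun [set: T] D /\ (forall x, fenchel f (D x) < +oo)
  end.

(* V is meaningful in [-oo, +oo] at D: both expectations exist and their
   difference is not of the form oo - oo.  For the classic objective this is
   automatic, both integrands being measurable and nonpositive. *)
Definition value_defined (o : objective) (P Q : probability T R) (D : T -> R) :
    Prop :=
  match o with
  | ClassicGAN => True
  | WassersteinGAN c =>
      [/\ expectation_exists P (fun x => (D x)%:E),
          expectation_exists Q (ctransform c D) &
          (\int[P]_x (D x)%:E) +? (- \int[Q]_x ctransform c D x)]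
  | FGAN f =>
      [/\ expectation_exists P (fun x => (D x)%:E),
          expectation_exists Q (fun x => fenchel f (D x)) &
          (\int[P]_x (D x)%:E) +? (- \int[Q]_x fenchel f (D x))]
  end.

Definition admissible_values (o : objective) (P Q : probability T R) :
    set (\bar R) :=
  [set gan_value o P Q D | D in
     [set D | admissible o D /\ value_defined o P Q D]].

(* A seminorm need only be defined on a linear subspace E of the functions
   T -> R; its values outside E are irrelevant. *)
Record seminorm_on (E : set (T -> R)) (N : (T -> R) -> R) : Prop := {
  seminorm_dom : submod_closed (mem E) ;
  seminorm_ge0 : forall u, E u -> (0 <= N u)%R ;
  seminormZ : forall (a : R) u, E u -> N (a *: u)%R = (`|a| * N u)%R ;
  seminormD : forall u v, E u -> E v -> (N (u + v) <= N u + N v)%R }.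

End Objectives.

Section ProximalGap.
Context (T : Type) (R : realType) (ThD ThG : Type).
Variables (V : ThD -> ThG -> \bar R) (D : ThD -> T -> R).
Variables (N : (T -> R) -> R) (lambda : R).
Local Open Scope ereal_scope.

Definition disc_values (tg : ThG) : set (\bar R) := range (fun td => V td tg).

Definition worst_disc (tg : ThG) : \bar R := ereal_sup (disc_values tg).

Definition prox_values (td : ThD) (tg : ThG) : set (\bar R) :=
  range (fun td' => V td' tg -
    (lambda * N (fun x => D td' x - D td x) ^+ 2)%R%:E).

Definition prox_objective (td : ThD) (tg : ThG) : \bar R :=
  ereal_sup (prox_values td tg).

Definition prox_gen_values (td : ThD) : set (\bar R) :=
  range (prox_objective td).

Definition prox_worst_gen (td : ThD) : \bar R := ereal_inf (prox_gen_values td).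

Definition prox_duality_gap (td : ThD) (tg : ThG) : \bar R :=
  worst_disc tg - prox_worst_gen td.

End ProximalGap.

(* Main.v *)
(* For lambda = 0 the proximal objective no longer depends on the discriminator
   and equals the worst-discriminator value W(g) = sup_D V(D, g), so the gap is
   W(g) - min_g' W(g').  When P_g = P_r, every V(D, g) is at most a universal
   constant: log (1/2) since u (1 - u) <= 1/4, or 0 since D <= D^c and
   D <= f^* o D.  Against every generator g' this constant is the value of
   a constant discriminator: 1/2, or 0, or a subgradient of f at 1. *)
Require Import Defs.
Import Order.TTheory GRing.Theory Num.Theory.
Import numFieldNormedType.Exports.
From mathcomp Require Import ring lra.
Local Open Scope classical_set_scope.
Local Open Scope ring_scope.

Section Integrals.
Set Implicit Arguments.
Unset Strict Implicit.
Context (d : measure_display) (T : measurableType d) (R : realType).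
Local Open Scope ereal_scope.

(** No integrability is required: positive parts grow, negative parts shrink, and subtraction in
    [\bar R], with oo - oo read as -oo, respects both. *)
Lemma le_integral_measurable (mu : {measure set T -> \bar R}) (f g : T -> \bar R) :
  measurable_fun [set: T] f -> measurable_fun [set: T] g ->
  (forall x, f x <= g x) -> \int[mu]_x f x <= \int[mu]_x g x.
Proof.
move=> mf mg fg; rewrite (integralE mu _ f) (integralE mu _ g); apply: leeB.
- apply: ge0_le_integral => //; [exact: measurable_funepos..|].
  by move=> x _; apply: (@funepos_le _ _ [set: T]) => //; rewrite inE.
- apply: ge0_le_integral => //; [exact: measurable_funeneg..|].
  by move=> x _; apply: (@funeneg_le _ _ [set: T]) => //; rewrite inE.
Qed.

Lemma integral_probability_cst (P : probability T R) (r : R) :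
  \int[P]_x r%:E = r%:E.
Proof. 
rewrite integral_cst// -[RHS]mule1; congr (_ * _); exact: probability_setT. Qed.

Lemma expectation_exists_cst (P : probability T R) (r : R) :
  expectation_exists P (fun=> r%:E).
Proof.
split; first exact: measurable_cst.
left; have -> : (fun=> r%:E)^\+ = (fun=> (Num.max r 0)%:E) :> (T -> \bar R).
  by apply/funext => x; rewrite funeposE EFin_max.
by rewrite integral_probability_cst ltry.
Qed.

Lemma measurable_fun_lne (D : T -> R) : measurable_fun [set: T] D ->
  measurable_fun [set: T] (fun x => lne (D x)%:E).
Proof.
move=> mD; rewrite /lne; apply: measurable_fun_ifT => //.
- by apply: measurable_fun_ler => //; exact: measurable_cst.
- apply/measurable_EFinP; exact: (measurableT_comp (@measurable_ln R)).
Qed.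

End Integrals.

Section Pointwise.
Set Implicit Arguments.
Unset Strict Implicit.
Context (R : realType).
Local Open Scope ereal_scope.

Lemma lneD_onem_le (u : R) : (0 <= u <= 1)%R ->
  lne u%:E + lne (1 - u)%:E <= (ln 2^-1 + ln 2^-1)%:E.
Proof.
move=> /andP[u0 u1].
(* At either endpoint one logarithm is -oo and absorbs the sum. *)
have [u_le0|u_gt0] := leP u 0%R; first by rewrite le0_lneNy// leNye.
have [v_le0|v_gt0] := leP (1 - u)%R 0%R.
  by rewrite [X in _ + X]le0_lneNy// addeNy leNye.
rewrite !lne_EFin// -EFinD lee_fin -!lnM ?posrE//.
rewrite ler_ln ?posrE ?mulr_gt0//.
(* Uses $u(1-u) = 1/4 - (u-1/2)^2$. *)
have := sqr_ge0 (u - 2^-1)%R; nra.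
Qed.

Lemma le_ctransform (d : measure_display) (X : measurableType d)
    (c : X -> X -> R) (D : X -> R) (x : X) :
  c x x = 0%R -> (D x)%:E <= ctransform c D x.
Proof. by move=> cxx; apply: ereal_sup_ubound; exists x => //; rewrite cxx subr0. Qed.

Lemma le_fenchel (f : R -> R) (y : R) : f 1%R = 0%R -> y%:E <= fenchel f y.
Proof.
move=> f1; apply: ereal_sup_ubound; exists 1%R; last by rewrite f1 mulr1 subr0.
by rewrite /= in_itv /= ler01.
Qed.

(* Chord slopes of a convex function at 1 increase, so their supremum over
   [0, 1[ is a subgradient there. *)
Lemma convex_subgradient1 (f : R -> R) :
  convex_function (`[0%R, +oo[ : set R) f -> f 1%R = 0%R ->
  exists y : R, forall t : R, (0 <= t -> y * (t - 1) <= f t)%R.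
Proof.
move=> cf f1.
have slopes (s t : R) : (0 <= s -> s < 1 -> 1 < t ->
    f s / (s - 1) <= f t / (t - 1))%R.
  move=> s0 s1 t1.
  have st : (0 < t - s)%R by lra.
  (* The weight that makes 1 the convex combination $ps + (1-p)t$. *)
  pose p := ((t - 1) / (t - s))%R.
  have p0 : (0 <= p)%R by rewrite divr_ge0//; lra.
  have p1 : (p <= 1)%R by rewrite ler_pdivrMr//; lra.
  have : (f 1 <= p * f s + (1 - p) * f t)%R.
    have {1}-> : (1 = p * s + (1 - p) * t)%R by rewrite /p; field; lra.
    apply: (cf (Itv01 p0 p1) s t); rewrite inE/= in_itv/= andbT//.
    exact: ltW (lt_trans ltr01 t1).
  rewrite f1.
  have -> : (p * f s + (1 - p) * f t = ((t - 1) * f s + (1 - s) * f t) / (t - s))%R.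
    by rewrite /p; field; lra.
  rewrite ler_pdivlMr// mul0r => h.
  (* The denominator $s-1$ is negative, so the sign moves to the numerator before clearing it. *)
  rewrite -[(s - 1)%R]opprB invrN mulrN -mulNr ler_pdivrMr; last by lra.
  rewrite mulrAC ler_pdivlMr; last by lra.
  lra.
pose S : set R := [set (f s / (s - 1))%R | s in `[0%R, 1%R[].
have S0 : S !=set0.
  by exists (f 0 / (0 - 1))%R, 0%R => //; rewrite /= in_itv/= lexx ltr01.
have Sub (t : R) : (1 < t)%R -> ubound S (f t / (t - 1))%R.
  by move=> t1 x [s /=]; rewrite in_itv/= => /andP[s0 s1] <-; exact: slopes.
exists (sup S) => t t0.
have [t1|t1|->] := ltgtP t 1%R.
- have : (f t / (t - 1) <= sup S)%R.
    (* [sup] is meaningful only on a bounded set; the slope of the chord from 1 to 2 is a bound. *)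
    apply: ub_le_sup; first by exists (f 2 / (2 - 1))%R; apply: Sub; lra.
    by exists t => //; rewrite /= in_itv/= t0.
  rewrite -[(t - 1)%R]opprB invrN mulrN -mulNr ler_pdivrMr; last by lra.
  lra.
- have : (sup S <= f t / (t - 1))%R by apply: ge_sup => //; exact: Sub.
  by rewrite ler_pdivlMr//; lra.
- by rewrite subrr mulr0 f1.
Qed.

(** The subgradient inequality $y(t-1) \le f(t)$ rearranges to $yt - f(t) \le y$, with equality at
    $t = 1$. The constant discriminator $y$ then has value $y - f^*(y) = 0$. *)
Lemma fenchel_fixpoint (f : R -> R) :
  convex_function (`[0%R, +oo[ : set R) f -> f 1%R = 0%R ->
  exists y : R, fenchel f y = y%:E.
Proof.
move=> cf f1; have [y yP] := convex_subgradient1 cf f1.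
exists y; apply/eqP; rewrite eq_le le_fenchel// andbT.
apply: ge_ereal_sup => x [t /=]; rewrite in_itv/= andbT => t0 <-.
by rewrite lee_fin; have := yP t t0; lra.
Qed.

End Pointwise.

Section Equilibrium.
Set Implicit Arguments.
Unset Strict Implicit.
Context (d : measure_display) (T : measurableType d) (R : realType).
Implicit Types (P Q : probability T R) (o : objective T R) (D : T -> R).
Local Open Scope ereal_scope.

Definition equilibrium_value o : R :=
  if o is ClassicGAN then ln 2^-1 else 0%R.

Lemma integral_same_distribution P Q (g : T -> \bar R) :
  same_distribution Q P -> \int[Q]_x g x = \int[P]_x g x.
Proof. by move=> QP; apply: eq_measure_integral => A mA _; exact: QP. Qed.

Lemma classic_value_le P D : admissible (@ClassicGAN _ T R) D ->
  gan_value (@ClassicGAN _ T R) P P D <= (ln 2^-1)%:E.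
Proof.
move=> [mD D01] /=.
have mD' : measurable_fun [set: T] (fun x => 1 - D x)%R.
  by apply: measurable_funB => //; exact: measurable_cst.
(* The logarithms are nonpositive and may integrate to -oo; their negatives are nonnegative, so
   additivity of the integral needs only measurability. *)
pose F x := - lne (D x)%:E; pose G x := - lne (1 - D x)%:E.
have mF : measurable_fun [set: T] F.
  by apply: measurableT_comp => //; exact: measurable_fun_lne.
have mG : measurable_fun [set: T] G.
  by apply: measurableT_comp => //; exact: measurable_fun_lne.
have F0 x : 0 <= F x.
  by rewrite oppe_ge0 lne_le0 lee_fin; have /andP[] := D01 x.
have G0 x : 0 <= G x.
  by rewrite oppe_ge0 lne_le0 lee_fin gerBl; have /andP[] := D01 x.
have -> : \int[P]_x lne (D x)%:E = - \int[P]_x F x.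
  by rewrite -integral_ge0N//; apply: eq_integral => x _; rewrite oppeK.
have -> : \int[P]_x lne (1 - D x)%:E = - \int[P]_x G x.
  by rewrite -integral_ge0N//; apply: eq_integral => x _; rewrite oppeK.
have iF0 : 0 <= \int[P]_x F x by exact: integral_ge0.
have iG0 : 0 <= \int[P]_x G x by exact: integral_ge0.
have le : (- (ln 2^-1 + ln 2^-1))%:E <= \int[P]_x F x + \int[P]_x G x.
  rewrite -ge0_integralD// -(integral_probability_cst P).
  apply: le_integral_measurable => //; first exact: emeasurable_funD.
  move=> x; rewrite EFinN /F /G leeNl oppeD; last first.
    by apply: ge0_adde_def; rewrite inE; [exact: F0|exact: G0].
  by rewrite !oppeK; exact: lneD_onem_le.
rewrite !muleN -oppeD; last first.
  by apply: ge0_adde_def; rewrite inE mule_ge0.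
rewrite -ge0_muleDr// leeNl -EFinN.
have -> : (- ln 2^-1 = 2^-1 * - (ln 2^-1 + ln 2^-1) :> R)%R by lra.
by rewrite EFinM; exact: lee_wpmul2l.
Qed.

Lemma gan_value_le o P Q D : valid_objective o -> same_distribution Q P ->
  admissible o D -> value_defined o P Q D ->
  gan_value o P Q D <= (equilibrium_value o)%:E.
Proof.
case: o => [|c|f] /= oV QP aD vD; rewrite !(integral_same_distribution _ QP).
- exact: classic_value_le.
(* Measurability of [D] and of its c-transform is read off from [value_defined]. *)
- have [[mD _] [mDc _] _] := vD; rewrite sube_le0.
  by apply: le_integral_measurable => // x; apply: le_ctransform; rewrite oV.2.
- have [[mD _] [mDf _] _] := vD; rewrite sube_le0.
  by apply: le_integral_measurable => // x; apply: le_fenchel; case: oV.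
Qed.

Lemma equilibrium_value_attained o P Q : valid_objective o ->
  admissible_values o P Q (equilibrium_value o)%:E.
Proof.
case: o => [|c|f] /= oV.
- exists (cst 2^-1%R) => /=.
    by split=> //; split; [exact: measurable_cst|move=> _; lra].
  have -> : (1 - 2^-1 = 2^-1 :> R)%R by lra.
  rewrite leNgt invr_gt0 ltr0n/= !integral_probability_cst -!EFinM -EFinD; congr EFin; lra.
- have [c0 cxx] := oV.
  (* The supremum of $-c(x,y)$ over $y$ is 0, reached at $y = x$. *)
  have D0 : ctransform c (cst 0%R) = fun=> 0%:E.
    apply/funext => x; apply/eqP; rewrite eq_le; apply/andP; split.
      apply: ge_ereal_sup => _ [y _ <-] /=.
      by rewrite lee_fin sub0r oppr_le0.
    exact: le_ctransform.
  exists (cst 0%R) => /=; last by rewrite D0 !integral_probability_cst subee.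
  split.
    (* With $\varphi = 0$ the infimum of $c(x,y)$ over $x$ is 0, so the zero function is
       c-concave. *)
    exists (fun=> 0) => y; apply/eqP; rewrite eq_le; apply/andP; split.
      apply: le_ereal_inf_tmp => _ [x _ <-].
      by rewrite add0e lee_fin.
    by apply: ereal_inf_lbound; exists y => //; rewrite add0e cxx.
  rewrite D0 !integral_probability_cst.
  by split=> //; exact: expectation_exists_cst.
- have [cf _ f1] := oV; have [y fy] := fenchel_fixpoint cf f1.
  exists (cst y) => /=; last by rewrite fy !integral_probability_cst subee.
  split; first by split=> [|_]; [exact: measurable_cst|rewrite fy ltry].
  rewrite fy !integral_probability_cst.
  by split=> //; exact: expectation_exists_cst.
Qed.

End Equilibrium.

Lemma prox_objective0 (T : Type) (R : realType) (ThD ThG : Type)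
    (V : ThD -> ThG -> \bar R) (D : ThD -> T -> R) (N : (T -> R) -> R)
    (td : ThD) :
  prox_objective V D N 0 td = worst_disc V.
Proof.
apply/funext => tg; congr (ereal_sup (_ @` _)).
by apply/funext => td'; rewrite mul0r sube0.
Qed.

Theorem theorem2 (R : realType) (d : measure_display) (T : measurableType d)
    (mu : {measure set T -> \bar R})
    (ThD ThG : Type) (D : ThD -> T -> R)
    (Pr : probability T R) (P : ThG -> probability T R)
    (E : set (T -> R)) (N : (T -> R) -> R) (o : objective T R)
    (Pr_density : has_density mu Pr)
    (P_density : forall tg, has_density mu (P tg))
    (o_valid : valid_objective o)
    (N_seminorm : seminorm_on E N)
    (D_dom : forall td, E (D td))
    (D_admissible : forall td, admissible o (D td)) :
  let V := fun td tg => gan_value o Pr (P tg) (D td) in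
  (forall td tg, value_defined o Pr (P tg) (D td)) ->
  (forall tg, [/\ has_emax (disc_values V tg),
                  worst_disc V tg \is a fin_num &
                  worst_disc V tg = ereal_sup (admissible_values o Pr (P tg))]) ->
  (forall td tg, has_emax (prox_values V D N 0 td tg)) ->
  (forall td, has_emin (prox_gen_values V D N 0 td)) ->
  forall (td : ThD) (tg : ThG),
    same_distribution (P tg) Pr -> prox_duality_gap V D N 0 td tg = 0%E.
Proof.
move=> V Vdef Vopt _ _ td tg PPr.
have [_ Vfin _] := Vopt tg.
rewrite /prox_duality_gap.
(* Finiteness of [worst_disc V tg] is what makes the difference 0, as oo - oo is not. *)
suff -> : prox_worst_gen V D N 0 td = worst_disc V tg by rewrite subee.
rewrite /prox_worst_gen /prox_gen_values prox_objective0.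
apply/eqP; rewrite eq_le; apply/andP; split.
  by apply: ereal_inf_lbound; exists tg.
apply: le_ereal_inf_tmp => _ [tg' _ <-].
apply: (@le_trans _ _ (equilibrium_value o)%:E).
  by apply: ge_ereal_sup => _ [td' _ <-]; exact: gan_value_le.
(* The constant discriminator may lie outside the parametrized family; it counts because the worst
   discriminator attains the supremum over all admissible ones. *)
have [_ _ ->] := Vopt tg'.
exact/ereal_sup_ubound/equilibrium_value_attained.
Qed.
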